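(* Let $F_k$ be the free group on $k\ge1$ generators, with its free generating set. For every integer $r\ge1$, $$r\,\mathcal{CC}(r)=\sum_{d\mid r}\phi(d)\,\mathcal C(r/d),$$ where $\phi$ denotes the Euler totient function.
   Context: For $g\in F_k$, $|g|$ is the length of the shortest word in the generators and their inverses representing $g$, and $|g|_c$ is the minimum of $|h|$ over all $h$ conjugate to $g$; $|\cdot|_c$ is constant on conjugacy classes. $\mathcal C(r)$ is the number of $g\in F_k$ with $|g|=r$ and $|g|_c=r$ (i.e. the number of cyclically reduced words of length $r$), and $\mathcal{CC}(r)$ is the number of conjugacy classes $C$ of $F_k$ with $|C|_c=r$. *)

(* Defs.v *)
From HB Require Import structures.
From mathcomp Require Import all_boot finmap.
From mathcomp Require Import boolp classical_sets functions cardinality.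

Set Implicit Arguments.
Unset Strict Implicit.
Unset Printing Implicit Defensive.

Local Open Scope group_scope.
Local Open Scope classical_set_scope.

Section Words.
Variable T : choiceType.

(* The letter (x, false) is the generator x, and (x, true) its inverse. *)
Local Notation letter := (T * bool)%type.
Implicit Types (a b : letter) (u v w : seq letter).

Definition inv_letter a : letter := (a.1, ~~ a.2).

Definition reduced w := sorted (fun a b => b != inv_letter a) w.

Definition push a w :=
  if w is b :: w' then if b == inv_letter a then w' else a :: w else [:: a].

(* The reduced form of the concatenation u ++ v, when v is reduced. *)
Definition word_mul u v := foldr push v u.

Definition word_inv w := rev (map inv_letter w).

Lemma inv_letterK : involutive inv_letter.
Proof. by case=> x e; rewrite /inv_letter /= negbK. Qed.

Lemma reduced_push a w : reduced w -> reduced (push a w).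
Proof.
case: w => [|b w] //= bw; case: ifPn => [_|ba]; first exact: path_sorted bw.
by rewrite /= ba.
Qed.

Lemma push_reduced a w : reduced (a :: w) -> push a w = a :: w.
Proof. by case: w => [|b w] //= /andP[/negbTE-> _]. Qed.

Lemma reduced_mul u v : reduced v -> reduced (word_mul u v).
Proof. by move=> rv; elim: u => //= a u; apply: reduced_push. Qed.

Lemma pushK a w : reduced w -> push a (push (inv_letter a) w) = w.
Proof.
case: w => [|b w] /= rw; first by rewrite eqxx.
rewrite inv_letterK; case: eqP rw => [->|_] rw; first exact: push_reduced.
by rewrite /= eqxx.
Qed.

Lemma word_mul_push a u v :
  reduced v -> word_mul (push a u) v = push a (word_mul u v).
Proof.
move=> rv; case: u => [|b u] //=; case: ifP => // /eqP->.
by rewrite pushK //; apply: reduced_mul.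
Qed.

Lemma word_mulA u v w : reduced w ->
  word_mul u (word_mul v w) = word_mul (word_mul u v) w.
Proof. by move=> rw; elim: u => //= a u ->; rewrite word_mul_push. Qed.

Lemma word_mulw0 w : reduced w -> word_mul w [::] = w.
Proof.
elim: w => //= a w IHw rw.
by rewrite IHw ?push_reduced //; apply: path_sorted rw.
Qed.

Lemma word_invK : involutive word_inv.
Proof.
by move=> w; rewrite /word_inv map_rev revK mapK //; apply: inv_letterK.
Qed.

Lemma reduced_inv w : reduced w -> reduced (word_inv w).
Proof.
rewrite /reduced /word_inv rev_sorted sorted_map.
apply: sub_sorted => a b; apply: contra => /eqP ba.
by rewrite ba inv_letterK.
Qed.

Lemma word_mulVK w v : reduced v -> word_mul w (word_mul (word_inv w) v) = v.
Proof.
elim: w v => //= a w IHw v rv.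
rewrite /word_inv map_cons rev_cons /word_mul foldr_rcons -/(word_inv w).
by rewrite [foldr _ _ w]IHw ?pushK //; apply: reduced_push.
Qed.

Lemma word_mulwV w : reduced w -> word_mul w (word_inv w) = [::].
Proof.
by move=> rw; rewrite -(word_mulw0 (reduced_inv rw)) word_mulVK.
Qed.

Lemma word_mulVw w : reduced w -> word_mul (word_inv w) w = [::].
Proof. by move/reduced_inv/word_mulwV; rewrite word_invK. Qed.

End Words.

Section WordEval.
Variables (T : choiceType) (G : groupType) (f : T -> G).
Implicit Types (a : T * bool) (w : seq (T * bool)).

Definition letter_eval a : G := if a.2 then (f a.1)^-1 else f a.1.

Definition word_eval w : G := \prod_(a <- w) letter_eval a.

Lemma word_eval_push a w : word_eval (push a w) = letter_eval a * word_eval w.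
Proof.
rewrite /word_eval; case: w => [|b w] /=.
  by rewrite big_seq1 big_nil mulg1.
case: ifP => [/eqP->|_]; rewrite !big_cons // mulgA.
suff -> : letter_eval a * letter_eval (inv_letter a) = 1 by rewrite mul1g.
by rewrite /letter_eval /=; case: a.2; rewrite /= ?mulVg ?mulgV.
Qed.

Lemma word_eval_mul u v : word_eval (word_mul u v) = word_eval u * word_eval v.
Proof.
elim: u => [|a u IHu] /=; first by rewrite /word_eval big_nil mul1g.
by rewrite word_eval_push IHu mulgA /word_eval big_cons.
Qed.

End WordEval.

Record free_group (T : choiceType) := FreeGroup {
  free_word :> seq (T * bool);
  free_word_reduced : reduced free_word }.

HB.instance Definition _ (T : choiceType) := [isSub for @free_word T].
HB.instance Definition _ (T : choiceType) := [Choice of free_group T by <:].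

Section FreeGroup.
Variable T : choiceType.
Implicit Types g h : free_group T.

Definition free_one : free_group T := @FreeGroup T [::] isT.

Definition free_mul g h : free_group T :=
  FreeGroup (reduced_mul g (free_word_reduced h)).

Definition free_inv g : free_group T :=
  FreeGroup (reduced_inv (free_word_reduced g)).

Fact free_mulA : associative free_mul.
Proof. by move=> x y z; apply/val_inj/word_mulA/free_word_reduced. Qed.

Fact free_mul1g : left_id free_one free_mul.
Proof. by move=> x; apply/val_inj. Qed.

Fact free_mulg1 : right_id free_one free_mul.
Proof. by move=> x; apply/val_inj/word_mulw0/free_word_reduced. Qed.

Fact free_mulVg : left_inverse free_one free_inv free_mul.
Proof. by move=> x; apply/val_inj/word_mulVw/free_word_reduced. Qed.

Fact free_mulgV : right_inverse free_one free_inv free_mul.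
Proof. by move=> x; apply/val_inj/word_mulwV/free_word_reduced. Qed.

HB.instance Definition _ := isGroup.Build (free_group T)
  free_mulA free_mul1g free_mulg1 free_mulVg free_mulgV.

Definition free_gen (x : T) : free_group T := @FreeGroup T [:: (x, false)] isT.

Lemma val_letter_eval (a : T * bool) :
  letter_eval free_gen a = [:: a] :> seq (T * bool).
Proof. by case: a => x []. Qed.

Lemma val_word_eval (w : seq (T * bool)) :
  word_eval free_gen w = word_mul w [::] :> seq (T * bool).
Proof.
rewrite /word_eval; elim: w => [|a w IHw]; first by rewrite big_nil.
by rewrite big_cons [LHS]/(word_mul _ _) val_letter_eval IHw.
Qed.

Lemma word_evalK g : word_eval free_gen g = g.
Proof.
by apply/val_inj; rewrite /= val_word_eval word_mulw0 ?free_word_reduced.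
Qed.

Lemma free_group_universal (G : groupType) (f : T -> G) :
  exists F : free_group T -> G,
    [/\ {morph F : g h / g * h}, forall x, F (free_gen x) = f x
      & forall F' : free_group T -> G, {morph F' : g h / g * h} ->
          (forall x, F' (free_gen x) = f x) -> F' =1 F].
Proof.
exists (fun g => word_eval f g); split.
- by move=> g h; apply: word_eval_mul.
- by move=> x; rewrite /word_eval big_seq1.
move=> F' F'M F'f g; rewrite -[in LHS](word_evalK g) /word_eval.
have F'1 : F' 1 = 1 by apply: (@mulgI _ (F' 1)); rewrite -F'M !mulg1.
have F'V x : F' x^-1 = (F' x)^-1.
  by apply: (@mulgI _ (F' x)); rewrite -F'M !mulgV.
elim: (free_word g) => [|a w IHw]; first by rewrite !big_nil.
rewrite !big_cons F'M IHw; congr (_ * _).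
by rewrite /letter_eval; case: a.2; rewrite ?F'V F'f.
Qed.

Lemma word_length_subproof g :
  exists n, `[< exists2 w, word_eval free_gen w = g & size w = n >].
Proof. by exists (size g); apply/asboolP; exists g; rewrite ?word_evalK. Qed.

Definition word_length g : nat := ex_minn (word_length_subproof g).

Definition conjugacy_class g : set (free_group T) := [set g ^ x | x in setT].

Lemma conj_length_subproof g :
  exists n, `[< exists2 h, h \in conjugacy_class g & word_length h = n >].
Proof.
exists (word_length g); apply/asboolP; exists g => //.
by rewrite inE; exists 1; rewrite ?conjg1.
Qed.

Definition conj_length g : nat := ex_minn (conj_length_subproof g).

Lemma conjugacy_classJ g x : conjugacy_class (g ^ x) = conjugacy_class g.
Proof.
apply/seteqP; split=> [_ [y _ <-]|_ [y _ <-]].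
  by exists (x * y) => //; rewrite conjgM.
by exists (x^-1 * y) => //; rewrite -conjgM mulgA mulgV mul1g.
Qed.

Lemma conj_lengthJ g x : conj_length (g ^ x) = conj_length g.
Proof.
by rewrite /conj_length; apply: eq_ex_minn => n; rewrite conjugacy_classJ.
Qed.

End FreeGroup.

Definition cyc_reduced (T : choiceType) (r : nat) : set (free_group T) :=
  [set g | word_length g = r /\ conj_length g = r].

(* The length of a conjugacy class is that of any of its elements, which is
   well defined by conj_lengthJ. *)
Definition conj_classes (T : choiceType) (r : nat) : set (set (free_group T)) :=
  [set C | exists2 g, C = conjugacy_class g & conj_length g = r].

Lemma finite_word_length (T : finType) (r : nat) :
  finite_set [set g : free_group T | word_length g = r].
Proof.
pose F (t : r.-tuple (T * bool)) := word_eval (@free_gen T) t.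
apply: (@sub_finite_set _ _ (F @` setT)); last exact/finite_image/finite_finset.
move=> g /=; rewrite /word_length; case: ex_minnP => n /asboolP[w <- <-] _ rw.
by exists (Tuple (introT eqP rw)).
Qed.

Lemma finite_cyc_reduced (T : finType) (r : nat) :
  finite_set (@cyc_reduced T r).
Proof. by apply: sub_finite_set (finite_word_length T r) => g []. Qed.

Lemma finite_conj_classes (T : finType) (r : nat) :
  finite_set (@conj_classes T r).
Proof.
have := finite_image (@conjugacy_class T) (finite_word_length T r).
apply: sub_finite_set.
move=> _ [g -> ]; rewrite /conj_length; case: ex_minnP => n /asboolP[h + hn] _ nr.
rewrite inE => -[x _ xh]; exists h; first by rewrite /= hn.
by rewrite -xh conjugacy_classJ.
Qed.

(* fset_set is the empty set on infinite sets; finite_cyc_reduced and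
   finite_conj_classes rule this case out. *)
Definition num_cyc_reduced (k r : nat) : nat :=
  #|` fset_set (@cyc_reduced 'I_k r)|.

Definition num_conj_classes (k r : nat) : nat :=
  #|` fset_set (@conj_classes 'I_k r)|.

(* Main.v *)
Require Import Defs.
From mathcomp Require Import all_boot fingroup action zmodp finmap.
From mathcomp Require Import boolp classical_sets functions cardinality.

(* Every element of F_k is conjugate to a cyclically reduced word, and two
   cyclically reduced words are conjugate exactly when one is a rotation of the
   other; so the conjugacy classes of length r are the orbits of Z/r acting by
   rotation on the cyclically reduced words of length r. A word is fixed by the
   rotation by i exactly when it is gcd(i, r)-periodic, i.e. a power of a
   cyclically reduced word of length gcd(i, r), and Burnside's lemma gives
   r CC(r) = sum_(i < r) C(gcd(i, r)). Exactly phi(d) indices i < r satisfy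
   gcd(i, r) = r / d. *)

Set Implicit Arguments.
Unset Strict Implicit.
Unset Printing Implicit Defensive.

(** * Cyclically reduced words and conjugacy in the free group *)

Section CyclicallyReduced.
Variable T : choiceType.
Implicit Types (a b : T * bool) (u v w : seq (T * bool)) (g h : free_group T).

Local Open Scope group_scope.
Local Notation E := (word_eval (@free_gen T)).

Definition cyc_word w := path.cycle (fun a b => b != inv_letter a) w.

Lemma neq_inv_letter a : a != inv_letter a.
Proof. by case: a => y []; rewrite /inv_letter xpair_eqE /= andbF. Qed.

Lemma cyc_word_reduced w : cyc_word w -> reduced w.
Proof. by case: w => //= a w; rewrite rcons_path => /andP[]. Qed.

Lemma word_eval_cons a w : E (a :: w) = letter_eval (@free_gen T) a * E w.
Proof. exact: big_cons. Qed.

Lemma word_eval_cat u v : E (u ++ v) = E u * E v.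
Proof. exact: big_cat. Qed.

Lemma letter_eval_inv a :
  letter_eval (@free_gen T) (inv_letter a) = (letter_eval (@free_gen T) a)^-1.
Proof. by case: a => y []; rewrite /letter_eval /= ?invgK. Qed.

Lemma word_eval_inv w : E (word_inv w) = (E w)^-1.
Proof.
elim: w => [|a w IHw]; first by rewrite /word_eval !big_nil invg1.
rewrite /word_inv map_cons rev_cons -/(word_inv w) -cats1.
rewrite word_eval_cat IHw !word_eval_cons letter_eval_inv invMg.
by rewrite [E [::]]big_nil mulg1.
Qed.

Lemma val_eval_reduced w : reduced w -> E w = w :> seq _.
Proof. by move=> rw; rewrite val_word_eval word_mulw0. Qed.

Lemma size_word_eval w : size (E w) <= size w.
Proof.
rewrite val_word_eval; elim: w => //= a w IHw.
have size_push v : size (push a v) <= (size v).+1.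
  by case: v => //= b v; case: ifP => //= _; apply/leqW/leqnSn.
exact: leq_trans (size_push _) _.
Qed.

(** Evaluating a word never lengthens it, so the stored reduced word is a shortest one. *)
Lemma word_lengthE g : word_length g = size g.
Proof.
rewrite /word_length; case: ex_minnP => n /asboolP[w <- <-] min_w.
apply/eqP; rewrite eqn_leq size_word_eval andbT; apply: min_w.
by apply/asboolP; exists (E w); rewrite ?word_evalK.
Qed.

Lemma conj_length_le g x : conj_length g <= size (g ^ x).
Proof.
rewrite /conj_length; case: ex_minnP => n _; apply; apply/asboolP.
by exists (g ^ x); rewrite ?word_lengthE // inE; exists x.
Qed.

Lemma conj_length_attained g : exists x, size (g ^ x) = conj_length g.
Proof.
rewrite /conj_length; case: ex_minnP => n /asboolP[h + <-] _.
by rewrite inE => -[x _ <-]; exists x; rewrite word_lengthE.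
Qed.

(** If the last letter were inverse to the first, conjugating by the first letter would delete both
    and contradict minimality. *)
Lemma cyc_word_min g : (forall x, size g <= size (g ^ x)) -> cyc_word g.
Proof.
move=> min_g; have := free_word_reduced g.
case Dg: (free_word g) => [|a w] //= rw; rewrite /cyc_word /= rcons_path.
apply/andP; split=> //=.
case/lastP: w Dg {rw} => [|u b] Dg; first exact: neq_inv_letter.
rewrite last_rcons; apply/eqP => ab.
have := min_g (E [:: a]); suff -> : g ^ E [:: a] = E u.
  by rewrite leqNgt Dg /= size_rcons !ltnS (leq_trans (size_word_eval u)).
rewrite -[g]word_evalK Dg -cats1 !word_eval_cons word_eval_cat.
rewrite word_eval_cons [E [::]]big_nil !mulg1 ab letter_eval_inv.
by rewrite conjgE invgK !mulgA mulgV mul1g mulgK.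
Qed.

(* If the first letter of x cancels against w, then passing to a rotation of w
   shortens x; otherwise there is no cancellation at all in x^-1 w x. *)
Lemma conj_cyc_word w x : cyc_word w -> w != [::] -> reduced x ->
  exists p n, E w ^ E x = word_inv p ++ rot n w ++ p :> seq _.
Proof.
elim: x w => [|a x IHx] w cw w0 rax.
  exists [::], 0; rewrite [E [::]]big_nil conjg1 rot0 cats0.
  exact/val_eval_reduced/cyc_word_reduced.
have rx : reduced x := path_sorted rax.
have step n : E (rot n w) = E w ^ E [:: a] ->
    exists p n, E w ^ E (a :: x) = word_inv p ++ rot n w ++ p :> seq _.
  move=> wa; have := IHx (rot n w) _ _ rx.
  rewrite /cyc_word rot_cycle -size_eq0 size_rot size_eq0.
  case=> // p [m]; rewrite rot_rot_add => wE; exists p, (rot_add w n m).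
  by rewrite -wE wa -conjgM -word_eval_cat.
case: w cw w0 step => // b w cw _ step; have [ba|ab] := altP (b =P a).
  apply: (step 1%N); rewrite rot1_cons -cats1 word_eval_cat -ba !word_eval_cons.
  by rewrite [E [::]]big_nil !mulg1 conjgE mulgA mulKg.
have [ca|ac] := altP (inv_letter (last b w) =P a).
  apply: (step (size w)); rewrite -(size_belast b) (lastI b w) -cats1.
  rewrite rot_size_cat !word_eval_cat !word_eval_cons [E [::]]big_nil !mulg1.
  by rewrite -ca letter_eval_inv conjgE invgK mulgK.
exists (a :: x), 0; rewrite rot0 conjgE -word_eval_inv -!word_eval_cat.
rewrite val_eval_reduced //.
rewrite /word_inv map_cons rev_cons cat_rcons /reduced sorted_cat_cons.
rewrite -rev_cons -map_cons -[X in X && _]/(reduced (word_inv (a :: x))).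
rewrite reduced_inv //= inv_letterK ab cat_path /=.
move: cw; rewrite /cyc_word /= rcons_path => /andP[-> _] /=.
by rewrite [path _ _ x]rax andbT eq_sym.
Qed.

(** By [conj_cyc_word] the reduced word of any conjugate contains a full rotation of [g], so it is
    at least as long. *)
Lemma conj_length_cyc g : cyc_word g -> conj_length g = size g.
Proof.
move=> cg; apply/eqP; rewrite eqn_leq -{2}(conjg1 g).
rewrite conj_length_le /=; have [x <-] := conj_length_attained g.
have [->//|g0] := eqVneq (free_word g) [::].
have [p [n]] := conj_cyc_word cg g0 (free_word_reduced x).
by rewrite !word_evalK => ->; rewrite 2!size_cat size_rot addnCA leq_addr.
Qed.

Lemma cyc_reducedP r g : cyc_reduced r g <-> size g = r /\ cyc_word g.
Proof.
rewrite /cyc_reduced /= word_lengthE; split=> -[gr cg]; split=> //.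
  by apply: cyc_word_min => x; rewrite gr -cg conj_length_le.
by rewrite conj_length_cyc.
Qed.

Lemma conjugacy_class_id g : conjugacy_class g g.
Proof. by exists 1; rewrite ?conjg1. Qed.

(** Conjugating a product $uv$ by $u$ gives $vu$. *)
Lemma conjugacy_class_rot g h n :
  h = rot n g :> seq _ -> conjugacy_class h = conjugacy_class g.
Proof.
move=> hg; rewrite -(word_evalK h) hg -[g in RHS]word_evalK.
rewrite -[free_word g in RHS](cat_take_drop n) !word_eval_cat.
by rewrite -[RHS](conjugacy_classJ _ (E (take n g))) conjgE !mulgA mulVg mul1g.
Qed.

(** Both words have the length of their common class, which leaves no room for the flanking words
    [p] and [word_inv p] of [conj_cyc_word]. *)
Lemma conj_cyc_rot g h : cyc_word g -> cyc_word h -> free_word g != [::] ->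
  conjugacy_class g h -> exists n, h = rot n g :> seq _.
Proof.
move=> cg ch g0 [x _ gxh].
have [p [n]] := conj_cyc_word cg g0 (free_word_reduced x).
rewrite !word_evalK gxh => Dh; exists n.
have: size h = size g by rewrite -!conj_length_cyc // -gxh conj_lengthJ.
rewrite Dh 2!size_cat size_rot addnCA -[RHS]addn0 => /addnI/eqP.
by rewrite addn_eq0 !size_eq0 => /andP[/eqP-> /eqP->]; rewrite cats0.
Qed.

Lemma conj_classes_cyc r C :
  conj_classes r C <-> exists g, [/\ size g = r, cyc_word g & C = conjugacy_class g].
Proof.
split=> [[g -> <-]|[g [<- cg ->]]]; last by exists g; rewrite ?conj_length_cyc.
have [x gx] := conj_length_attained g; exists (g ^ x).
split; rewrite ?conjugacy_classJ //; apply: cyc_word_min => y.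
by rewrite gx -conjgM conj_length_le.
Qed.

End CyclicallyReduced.

(** * Sorting residues by their gcd with the modulus *)

Section GcdSum.
Local Open Scope nat_scope.

(** The indices counted are the multiples $km$ with $k<d$ coprime to $d$. *)
Lemma card_gcdn_eq d m : 0 < m ->
  \sum_(i < d * m) (gcdn i (d * m) == m) = totient d.
Proof.
move=> m_gt0; rewrite totient_count_coprime big_mkord -!big_mkcond !sum1dep_card.
have ltm (k : 'I_d) : k * m < d * m by rewrite ltn_pmul2r.
pose f k := Ordinal (ltm k).
have f_inj : injective f.
  move=> k l [/eqP]; rewrite eqn_pmul2r // => /eqP; exact: val_inj.
rewrite -(card_imset _ f_inj); apply: eq_card => i; rewrite !inE.
apply/eqP/imsetP => [gim|[k]]; last first.
  rewrite inE coprime_sym => /eqP kd -> /=.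
  by rewrite -muln_gcdl kd mul1n.
have /dvdnP[k Dk] : m %| i by rewrite -[m in m %| _]gim dvdn_gcdl.
have ltkd : k < d by rewrite -(ltn_pmul2r m_gt0) -Dk.
exists (Ordinal ltkd); last exact: val_inj.
rewrite inE coprime_sym /coprime -(eqn_pmul2r m_gt0) /= muln_gcdl -Dk gim.
by rewrite mul1n.
Qed.

Lemma sum_gcdn n (F : nat -> nat) : 0 < n ->
  \sum_(i < n) F (gcdn i n) = \sum_(d <- divisors n) totient d * F (n %/ d).
Proof.
move=> n_gt0; have dvdK d : d %| n -> n %/ (n %/ d) = d.
  by move=> dn; rewrite divnA ?mulKn.
(* For each [i] exactly one divisor contributes, namely [d = n %/ gcdn i n]. *)
transitivity (\sum_(d <- divisors n) \sum_(i < n) (gcdn i n == n %/ d) * F (n %/ d)).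
  rewrite exchange_big; apply: eq_bigr => i _.
  have gn := dvdn_gcdr i n.
  rewrite (bigD1_seq (n %/ gcdn i n)) ?divisors_uniq //=; last first.
    rewrite -dvdn_divisors //; apply/dvdnP; exists (gcdn i n).
    by rewrite mulnC divnK.
  rewrite dvdK // eqxx mul1n big_seq_cond big1 ?addn0 // => d /andP[].
  rewrite -dvdn_divisors // => dn nd; case: (_ =P n %/ d) nd => // ->.
  by rewrite dvdK ?eqxx.
apply: eq_big_seq => d; rewrite -dvdn_divisors // => dn.
rewrite -big_distrl /= -(@card_gcdn_eq d (n %/ d)) ?divn_gt0 ?(dvdn_gt0 n_gt0) //.
  by rewrite [d * _]mulnC divnK.
exact: dvdn_leq.
Qed.

End GcdSum.

(** * Rotation of cyclic tuples and Burnside's lemma *)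

Section Necklaces.
Variables (A : finType) (e : rel A).
Local Open Scope nat_scope.

Definition cyc_tuples n := [set t : n.-tuple A | path.cycle e t].

(** Extending a tuple to a periodic function on [nat] turns rotations into shifts and lets tuples of
    different lengths be compared. *)
Definition periodic n (t : n.+1.-tuple A) (j : nat) := tnth t (inZp j).

(** The product in the group ['I_n.+1] is addition modulo [n.+1], so this is rotation to the left by
    [i]. *)
Definition rotate n (t : n.+1.-tuple A) (i : 'I_n.+1) :=
  [tuple tnth t (i * j)%g | j < n.+1].

Lemma periodic_ord n (t : n.+1.-tuple A) (j : 'I_n.+1) :
  periodic t j = tnth t j.
Proof. by rewrite /periodic valZpK. Qed.

Lemma periodic_dvd n d (t : n.+1.-tuple A) i j :
  i = j %[mod d] -> n.+1 %| d -> periodic t i = periodic t j.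
Proof.
move=> ij nd; congr tnth; apply/val_inj => /=.
by rewrite -(modn_dvdm i nd) ij modn_dvdm.
Qed.

Lemma periodic_inj n (t u : n.+1.-tuple A) : periodic t =1 periodic u -> t = u.
Proof. by move=> tu; apply: eq_from_tnth => j; rewrite -!periodic_ord. Qed.

Lemma cycle_periodic n (t : n.+1.-tuple A) :
  path.cycle e t <-> forall j, e (periodic t j) (periodic t j.+1).
Proof.
case: t => -[|x s] // st; set t := Tuple st.
have sn : size s = n by have /eqP[] := st.
have Dt j : periodic t j = nth x (x :: s) (j %% n.+1).
  by rewrite /periodic (tnth_nth x).
(* The letter [x] that closes the cycle sits at index [n], exactly where [i.+1] wraps around to
   0. *)
have Ds i : i < n.+1 -> nth x (rcons s x) i = periodic t i.+1.
  rewrite Dt nth_rcons sn ltnS leq_eqVlt => /predU1P[->|lt_in].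
    by rewrite ltnn eqxx modnn.
  by rewrite lt_in modn_small.
have Dxs i : i < n.+1 -> nth x (x :: rcons s x) i = periodic t i.
  by move=> lt_in; rewrite Dt -rcons_cons nth_rcons /= sn lt_in modn_small.
split=> [/(pathP x) es j|es]; last first.
  by apply/(pathP x) => i; rewrite size_rcons sn => lt_in; rewrite Ds ?Dxs.
have lt_j : j %% n.+1 < n.+1 by rewrite ltn_pmod.
have := es (j %% n.+1); rewrite size_rcons sn Ds ?Dxs // => /(_ lt_j).
have -> : periodic t (j %% n.+1) = periodic t j.
  by apply: (@periodic_dvd _ n.+1); rewrite ?modn_mod.
suff -> : periodic t (j %% n.+1).+1 = periodic t j.+1 by [].
by apply: (@periodic_dvd _ n.+1); rewrite // -!(addn1 (_ %% _)) -(addn1 j) modnDml.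
Qed.

Lemma periodic_rotate n (t : n.+1.-tuple A) i j :
  periodic (rotate t i) j = periodic t (i + j).
Proof.
rewrite /periodic tnth_mktuple; congr tnth; apply/val_inj => /=.
by rewrite modnDmr.
Qed.

Lemma val_rotate n (t : n.+1.-tuple A) i : rotate t i = rot i t :> seq _.
Proof.
apply: (@eq_from_nth _ (thead t)) => [|j]; first by rewrite size_rot !size_tuple.
rewrite size_tuple => ltjn; have le_in := ltnW (ltn_ord i).
rewrite -[j]/(val (Ordinal ltjn)) -tnth_nth -periodic_ord periodic_rotate /=.
rewrite /periodic (tnth_nth (thead t)) /= /rot nth_cat size_drop size_tuple.
case: ltnP => [jni|nij].
  by rewrite nth_drop modn_small // -ltn_subRL.
rewrite -[in LHS](subnK nij) addnCA subnKC ?(ltnW (ltn_ord i)) // modnDr.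
have lt_ji : j - (n.+1 - i) < i by rewrite ltn_subLR // subnK.
by rewrite nth_take // modn_small // (ltn_trans lt_ji).
Qed.

Fact rotate1 n : (@rotate n)^~ 1%g =1 id.
Proof. by move=> t; apply: eq_from_tnth => j; rewrite tnth_mktuple mul1g. Qed.

Fact rotateM n t : act_morph (@rotate n) t.
Proof.
by move=> a b; apply: eq_from_tnth => j; rewrite !tnth_mktuple mulgA.
Qed.

Canonical rotate_action n := TotalAction (@rotate1 n) (@rotateM n).

(** Being fixed means having period [i]; since [n.+1] is always a period, Bezout makes the gcd one
    too. Conversely, [i] is a multiple of the gcd. *)
Lemma rotate_fixP n (t : n.+1.-tuple A) i :
  rotate t i = t <-> forall j, periodic t (j + gcdn i n.+1) = periodic t j.
Proof.
split=> [ti j|tg]; last first.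
  apply: periodic_inj => j; rewrite periodic_rotate addnC.
  have /dvdnP[k ->] := dvdn_gcdl i n.+1.
  by elim: k => [|k IHk]; rewrite ?addn0 // mulSn addnCA addnC tg.
have tm k l : periodic t (l + k * i) = periodic t l.
  elim: k => [|k IHk]; first by rewrite addn0.
  by rewrite mulSn addnCA -periodic_rotate ti.
(* Here [a] makes the gcd plus [a * i] a multiple of [n.+1], so shifting by it changes nothing. *)
have [a _ dva] := Bezoutl i (ltn0Sn n); rewrite gcdnC -(tm a).
apply: (@periodic_dvd n n.+1) => //.
by rewrite -addnA -modnDmr (eqP dva) addn0.
Qed.

(** A fixed tuple is a shorter tuple of length the gcd, repeated. Both have the same periodic
    extension, and [cycle_periodic] reads membership in [cyc_tuples] off that extension alone. *)
Lemma card_rotate_fix n (i : 'I_n.+1) :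
  #|('Fix_(cyc_tuples n.+1 | @rotate_action n)[i])%g| = #|cyc_tuples (gcdn i n.+1)|.
Proof.
have := rotate_fixP _ i; have: 0 < gcdn i n.+1 by rewrite gcdn_gt0 orbT.
have := dvdn_gcdr i n.+1; case: (gcdn i n.+1) => // d dn _ fixP.
pose f (u : d.+1.-tuple A) := [tuple periodic u j | j < n.+1].
have fE u : periodic (f u) =1 periodic u.
  move=> j; rewrite {1}/periodic tnth_mktuple.
  by apply: (@periodic_dvd _ n.+1) => //=; rewrite modn_mod.
have f_inj : injective f.
  by move=> u v fuv; apply: periodic_inj => j; rewrite -!fE fuv.
rewrite -(card_imset _ f_inj); apply: eq_card => t.
rewrite !inE finset.sub1set inE; apply/andP/imsetP => [[ct /eqP/fixP tt]|[u]].
  pose u := [tuple periodic t j | j < d.+1].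
  have uE : periodic u =1 periodic t.
    move=> j; rewrite {1}/periodic tnth_mktuple /= [in RHS](divn_eq j d.+1) addnC.
    by elim: (j %/ d.+1) => [|k IHk]; rewrite ?addn0 // mulSn addnCA addnC tt.
  exists u; last by apply: periodic_inj => j; rewrite fE uE.
  by rewrite inE; apply/cycle_periodic => j; rewrite !uE; move: j; apply/cycle_periodic.
rewrite inE => /cycle_periodic cu ->; split.
  by apply/cycle_periodic => j; rewrite !fE.
apply/eqP/fixP => j; rewrite !fE; apply: (@periodic_dvd _ d.+1) => //.
by rewrite modnDr.
Qed.

Lemma card_rotate_orbits n :
  n.+1 * #|[set orbit (@rotate_action n) [set: 'I_n.+1] t | t in cyc_tuples n.+1]| =
    \sum_(d <- divisors n.+1) totient d * #|cyc_tuples (n.+1 %/ d)|.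
Proof.
have actsS : [acts [set: 'I_n.+1]%G, on cyc_tuples n.+1 | @rotate_action n].
  apply/actsP => i _ t; rewrite !inE /= val_rotate; exact: rot_cycle.
(* The factor [n.+1] is the order of the rotation group, as Burnside's lemma requires. *)
rewrite mulnC -[X in _ * X]card_ord -cardsT -(Frobenius_Cauchy actsS).
rewrite -(sum_gcdn (fun d => #|cyc_tuples d|)) //.
by apply: eq_big => [i|i _]; rewrite ?inE // card_rotate_fix.
Qed.

End Necklaces.

(** Transfers counts of classical sets, in possibly infinite types, to cardinals over finite
    types. *)
Lemma card_fset_set_image (I : finType) (U : choiceType) (S : {set I})
    (f : I -> U) :
  {in S &, injective f} -> #|` fset_set [set f x | x in [set` S]]%classic| = #|S|.
Proof.
move=> f_inj; have -> : fset_set [set f x | x in [set` S]]%classic =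
    [fset f x | x in S]%fset.
  apply/fsetP => y; rewrite in_fset_set; last exact/finite_image/finite_finset.
  by apply/idP/imfsetP; rewrite inE => -[x Sx]; exists x.
by rewrite card_in_imfset // cardE; apply/perm_size/uniq_perm;
  rewrite ?enum_finmem_uniq ?enum_uniq // => x; rewrite enum_finmemE mem_enum.
Qed.

(** * From tuples and rotation orbits to group elements and conjugacy classes *)

Section Counting.
Variables (T : finType) (n : nat).
Local Open Scope classical_set_scope.
Local Notation r := n.+1.
Local Notation word := (r.-tuple (T * bool)).
Local Notation S := (cyc_tuples (fun a b : T * bool => b != inv_letter a) r).
Implicit Types t u : word.

Definition tuple_elt (t : word) : free_group T := word_eval (@free_gen T) t.

Lemma val_tuple_elt t : t \in S -> tuple_elt t = t :> seq _.
Proof. by rewrite inE => ct; apply/val_eval_reduced/cyc_word_reduced. Qed.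

Lemma cyc_tuple_elt t : t \in S -> cyc_word (tuple_elt t).
Proof. by move=> St; rewrite val_tuple_elt //; rewrite inE in St. Qed.

Lemma tuple_elt_ex (g : free_group T) : size g = r -> cyc_word g ->
  exists2 t, t \in S & tuple_elt t = g.
Proof.
move=> gr cg; exists (Tuple (introT eqP gr)); first by rewrite inE.
exact: word_evalK.
Qed.

Lemma card_cyc_reduced : #|` fset_set (@cyc_reduced T r)| = #|S|.
Proof.
have <- : [set tuple_elt t | t in [set` S]] = @cyc_reduced T r.
  apply/seteqP; split=> [_ [t St <-]|g /cyc_reducedP[gr cg]].
    apply/cyc_reducedP; split; last exact: cyc_tuple_elt.
    by rewrite val_tuple_elt ?size_tuple.
  by have [t St tg] := tuple_elt_ex gr cg; exists t.
apply: card_fset_set_image => t u St Su tu; apply: val_inj => /=.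
by rewrite -!val_tuple_elt // tu.
Qed.

(** Taking a union over the orbit avoids choosing a representative; on orbits in [S] all the classes
    united coincide. *)
Definition orbit_class (O : {set word}) : set (free_group T) :=
  [set g | exists2 t, t \in O & conjugacy_class (tuple_elt t) g].

Local Notation rotations := (orbit (@rotate_action (T * bool)%type n) [set: 'I_r]%SET).

Lemma orbit_class_rotations t : t \in S ->
  orbit_class (rotations t) = conjugacy_class (tuple_elt t).
Proof.
move=> St; apply/seteqP; split=> [g [_ /imsetP[i _ ->]]|g tg]; last first.
  by exists t => //; apply: orbit_refl.
rewrite (@conjugacy_class_rot _ (tuple_elt t) _ i) // !val_tuple_elt ?val_rotate //.
by rewrite inE /= val_rotate rot_cycle; rewrite inE in St.
Qed.

(** This is the injectivity of [orbit_class] on orbits in [S]. *)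
Lemma rotations_class t u : t \in S -> u \in S ->
  conjugacy_class (tuple_elt t) = conjugacy_class (tuple_elt u) ->
  rotations t = rotations u.
Proof.
move=> St Su tu; apply/esym/orbit_eqP.
have t0 : free_word (tuple_elt t) != [::].
  by rewrite val_tuple_elt // -size_eq0 size_tuple.
have tCu : conjugacy_class (tuple_elt t) (tuple_elt u).
  by rewrite tu; apply: conjugacy_class_id.
have [m] := conj_cyc_rot (cyc_tuple_elt St) (cyc_tuple_elt Su) t0 tCu.
(* The rotation amount [m] is not bounded by [conj_cyc_rot]; from [r] on, [rot] is the identity. *)
rewrite !val_tuple_elt // => Du; have [ltmr|lerm] := ltnP m r.
  apply/imsetP; exists (Ordinal ltmr); rewrite ?inE //.
  by apply: val_inj; rewrite /= Du val_rotate.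
suff -> : u = t by apply: orbit_refl.
by apply: val_inj; rewrite /= Du rot_oversize // size_tuple.
Qed.

Lemma card_conj_classes : #|` fset_set (@conj_classes T r)| =
  #|[set rotations t | t in S]%SET|.
Proof.
have <- : [set orbit_class O | O in [set` [set rotations t | t in S]%SET]] =
    @conj_classes T r.
  apply/seteqP; split=> [_ [_ /imsetP[t St ->] <-]|C /conj_classes_cyc[g [gr cg ->]]].
    apply/conj_classes_cyc; exists (tuple_elt t).
    by rewrite orbit_class_rotations // cyc_tuple_elt // val_tuple_elt // size_tuple.
  have [t St <-] := tuple_elt_ex gr cg; exists (rotations t).
    exact: imset_f.
  exact: orbit_class_rotations.
apply: card_fset_set_image => _ _ /imsetP[t St ->] /imsetP[u Su ->].
by rewrite !orbit_class_rotations //; apply: rotations_class.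
Qed.

End Counting.

Theorem theorem14p2 (k r : nat) (hk : 1 <= k) (hr : 1 <= r) :
  r * num_conj_classes k r =
    \sum_(d <- divisors r) totient d * num_cyc_reduced k (r %/ d).
Proof.
case: r hr => // n _; rewrite /num_conj_classes card_conj_classes.
rewrite card_rotate_orbits; apply: eq_big_seq => d; rewrite -dvdn_divisors // => dn.
have d_gt0 : 0 < d := dvdn_gt0 (ltn0Sn n) dn.
(* [card_cyc_reduced] covers only positive lengths, so the quotient must be written as a
   successor. *)
have: 0 < n.+1 %/ d by rewrite divn_gt0 // dvdn_leq.
by case: (n.+1 %/ d) => // m _; rewrite /num_cyc_reduced card_cyc_reduced.
Qed.
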